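(* For every finite datum $(V,Q,\boldsymbol\alpha,\boldsymbol\beta)$ and every $\lambda\in[0,1]$, the unique real solution $\mathbf p_\lambda=(\mathbf p_\lambda(S))_{S\subset V}$ of the linear system $$\sum_{S\subset V}\mathbf p_\lambda(S)\,\mathbf 1_{\{S\subset R\}}\exp\{-\lambda m_V(S,V\setminus R)\}=\mathbf h(R)\qquad\text{for all }R\subset V$$ is a probability measure on $2^V$; that is, $\mathbf p_\lambda(S)\ge0$ for all $S\subset V$ and $\sum_{S\subset V}\mathbf p_\lambda(S)=1$. When $\lambda>1$, there exists a finite datum $(V,Q,\boldsymbol\alpha,\boldsymbol\beta)$ such that the corresponding solution $\mathbf p_\lambda$ has a negative coordinate.
   Context: A finite datum $(V,Q,\boldsymbol\alpha,\boldsymbol\beta)$ consists of a finite set $V$, a nonnegative substochastic matrix $Q=(Q_{xy})_{x,y\in V}$ with spectral radius $\rho(Q)<1$, and vectors $\boldsymbol\alpha=(\alpha_x)_{x\in V}\ge0$, $\boldsymbol\beta=(\beta_x)_{x\in V}\ge0$ with $\boldsymbol\alpha^{\mathsf T}(I-Q)^{-1}\boldsymbol\beta>0$. For $R\subset V$ let $\boldsymbol\alpha_R,\boldsymbol\beta_R$ be the coordinate restrictions to $R$, $Q_R$ the principal submatrix of $Q$ indexed by $R$, and $$Z_R=\boldsymbol\alpha_R^{\mathsf T}(I-Q_R)^{-1}\boldsymbol\beta_R,\qquad d_R=\det(I-Q_R),\qquad \mathbf h(R)=Z_R/Z_V,$$ with $d_\varnothing=1$, $Z_\varnothing=0$. For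 $S,A\subset V$, $m_V(S,A)$ is the random-walk loop mass of loops hitting both $S$ and $A$: the sum of $\frac1n\prod_{i=0}^{n-1}Q_{x_ix_{i+1}}$ over all $n\ge1$ and all closed sequences $(x_0,\dots,x_n)$ in $V$ with $x_n=x_0$ that visit both $S$ and $A$. For $S\subset R$ one has $\exp\{-m_V(S,V\setminus R)\}=\frac{d_Vd_{R\setminus S}}{d_{V\setminus S}d_R}$. The linear system is triangular with respect to inclusion with positive diagonal, so it has a unique real solution for every real $\lambda$. *)

(* Defs.v *)
From HB Require Import structures.
From mathcomp Require Import all_boot all_order all_algebra.
From mathcomp Require Import complex.
From mathcomp Require Import boolp classical_sets reals topology normedtype.
From mathcomp Require Import sequences exp.

Set Implicit Arguments.
Unset Strict Implicit.
Unset Printing Implicit Defensive.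

Import Order.TTheory GRing.Theory Num.Theory.
Import numFieldNormedType.Exports.

Local Open Scope ring_scope.

Definition spectral_radius (R : realType) (n : nat) (A : 'M[R]_n) : R :=
  sup [set r | exists2 z : R[i],
         eigenvalue (map_mx (real_complex R) A) z &
         r = ComplexField.Normc.normc z]%classic.

(* Data indexed by a finite type [V] are given as functions. Their restrictions
   to [W : {set V}] are matrices and vectors of size [#|W|], the elements of [W]
   being numbered by [enum_val]; the full matrix is the case [W = [set: V]]. *)
Section Restriction.
Context (R : realType) (V : finType).

Definition sub_mx (Q : V -> V -> R) (W : {set V}) : 'M[R]_#|W| :=
  \matrix_(i, j) Q (enum_val i) (enum_val j).

Definition sub_cV (a : V -> R) (W : {set V}) : 'cV[R]_#|W| :=
  \col_i a (enum_val i).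

Definition Zpart (Q : V -> V -> R) (alpha beta : V -> R) (W : {set V}) : R :=
  ((sub_cV alpha W)^T *m invmx (1%:M - sub_mx Q W) *m sub_cV beta W) 0 0.

Definition hfun (Q : V -> V -> R) (alpha beta : V -> R) (W : {set V}) : R :=
  Zpart Q alpha beta W / Zpart Q alpha beta [set: V].

Record finite_datum (Q : V -> V -> R) (alpha beta : V -> R) : Prop :=
  FiniteDatum {
    datum_Q_ge0 : forall x y, 0 <= Q x y;
    datum_Q_substochastic : forall x, \sum_y Q x y <= 1;
    datum_spectral_radius : spectral_radius (sub_mx Q [set: V]) < 1;
    datum_alpha_ge0 : forall x, 0 <= alpha x;
    datum_beta_ge0 : forall x, 0 <= beta x;
    datum_Z_gt0 : 0 < Zpart Q alpha beta [set: V]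
  }.

Definition hits n (x : {ffun 'I_n -> V}) (S : {set V}) : bool :=
  [exists i, x i \in S].

Definition loop_sum (Q : V -> V -> R) (S A : {set V}) (n : nat) : R :=
  \sum_(x : {ffun 'I_n.+1 -> V} |
         [&& x ord_max == x ord0, hits x S & hits x A])
    n%:R^-1 * \prod_(i < n) Q (x (inord i)) (x (inord i.+1)).

(* The limit is a real number; the series converges since the spectral radius
   of [Q] is smaller than 1. *)
Definition loop_mass (Q : V -> V -> R) (S A : {set V}) : R :=
  \big[+%R/0]_(1 <= n <oo) loop_sum Q S A n.

Definition solves_system (Q : V -> V -> R) (alpha beta : V -> R) (lambda : R)
    (p : {ffun {set V} -> R}) : Prop :=
  forall W : {set V},
    \sum_(S : {set V})
      p S * (S \subset W)%:R * expR (- (lambda * loop_mass Q S (~: W)))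
    = hfun Q alpha beta W.

Definition is_probability (p : {ffun {set V} -> R}) : Prop :=
  (forall S : {set V}, 0 <= p S) /\ \sum_(S : {set V}) p S = 1.

End Restriction.

(* Main.v *)
Require Import Defs.
From mathcomp Require Import all_boot all_order all_algebra.
From mathcomp Require Import complex.
From mathcomp Require Import boolp classical_sets reals topology normedtype.
From mathcomp Require Import sequences derive realfun exp.
From mathcomp Require Import ring lra.
From mathcomp Require Import fintype finset.

Set Implicit Arguments.
Unset Strict Implicit.
Unset Printing Implicit Defensive.

Import Order.TTheory GRing.Theory Num.Theory.
Import numFieldNormedType.Exports.

Local Open Scope ring_scope.

(** Let L(U) be the mass of all loops contained in U. Inclusion-exclusion on the
    loops hitting both S and the complement of W gives, for S inside W,
      m(S, V \ W) = L(V) - L(V \ S) - L(W) + L(W \ S),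
    so the coefficients of the system factor as weight S W / weight S V with
      weight S W = exp (lambda (L(W) - L(W \ S))).
    Uniqueness is triangularity. After a positive rescaling of the unknowns,
    positivity says that W |-> Z_W lies in the cone [in_cone] of the nonnegative
    combinations of the functions W |-> 1_(S \subset W) weight S W. As Z_W is a
    nonnegative combination of values of the Green's function G_W(x, y), it is
    enough to treat G_W; what carries an induction is the stronger claim that
    every finite product of such values is in the cone ([monomial_in_cone]).

    To prove it, let x be the starting point of the first factor. The product
    vanishes unless x is in W. If x is in W, put W' = W \ x and cut paths at
    their visits to x ([green_removal], [green_departure]): with f the mass of
    the excursions from x through W' back to x,
      G_W(x, z) = b(z) / (1 - f),
      G_W(y, z) = G_W'(y, z) + a(y) b(z) / (1 - f),
    where a, b and f are polynomials with nonnegative coefficients in the entries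
    of G_W'. The first factor supplies one power of 1 / (1 - f), and it is split
    as (1 - f)^(-lambda) (1 - f)^(-(1 - lambda)). Since lambda <= 1, the second
    half and everything else are limits of polynomials with nonnegative
    coefficients in the entries of G_W', hence in the cone of W' by
    induction. Since 1 / (1 - f) = exp (L(W) - L(W'))
    ([loop_total_removal]), the first half turns weight S W' into
    weight (x |: S) W, and the product is in the cone ([in_cone_insert]).

    The identity L(W) - L(W') = - ln (1 - f) is obtained by multiplying the steps
    out of x by a parameter s: the derivative of the loop mass in s is
    f / (1 - s f), and s = 0 kills the loops through x.

    If lambda > 1, take two points joined in both directions by steps of weight
    1/2, and paths from the first point to itself. Then f = 1/4, the system gives
    p({first point}) = (3/4)^(1 - lambda) > 1, and the total mass 1 forces the
    coordinate at the full set to be negative. *)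

(** * Limits and the logarithm *)

Local Open Scope classical_set_scope.
Local Open Scope ring_scope.

Lemma cvg_bigsum (R : realType) (I : Type) (r : seq I) (P : pred I)
    (u : nat -> I -> R) (l : I -> R) :
  (forall i, P i -> u ^~ i @ \oo --> l i) ->
  (fun n => \sum_(i <- r | P i) u n i) @ \oo --> \sum_(i <- r | P i) l i.
Proof.
move=> ul; elim: r => [|i r IH].
  under eq_fun do rewrite big_nil.
  by rewrite big_nil; exact: cvg_cst.
under eq_fun do rewrite big_cons.
by rewrite big_cons; case: ifPn => // Pi; apply: cvgD => //; exact: ul.
Qed.

Lemma cvg0_bigsum (R : realType) (I : Type) (r : seq I) (P : pred I)
    (u : nat -> I -> R) :
  (forall i, P i -> u ^~ i @ \oo --> (0 : R)) ->
  (fun n => \sum_(i <- r | P i) u n i) @ \oo --> (0 : R).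
Proof.
by move=> /(@cvg_bigsum R I r P u (fun=> 0)); rewrite big1_eq.
Qed.

Lemma cvgn_unique (R : realType) (u : nat -> R) (a b : R) :
  u @ \oo --> a -> u @ \oo --> b -> a = b.
Proof. by move=> ua ub; exact: (cvg_unique (@Rhausdorff R) ua ub). Qed.

Lemma cvgn_shiftS (R : realType) (u : nat -> R) (a : R) :
  u @ \oo --> a -> (fun n => u n.+1) @ \oo --> a.
Proof. by move=> ua; have := ua; rewrite -cvg_shiftS. Qed.

Lemma cvg0Mr (R : realType) (u : nat -> R) (a : R) :
  u @ \oo --> (0 : R) -> (fun n => a * u n) @ \oo --> (0 : R).
Proof. by rewrite -{2}(mulr0 a) => u0; exact: cvgMr. Qed.

Lemma cvg0_shift1 (R : realType) (u : nat -> R) :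
  u @ \oo --> (0 : R) -> (fun n => u n.-1) @ \oo --> (0 : R).
Proof. by move=> u0; rewrite -cvg_shiftS /=. Qed.

(** A logarithm recognised by its derivative: the mean value theorem on [0, 1]
    compares F N with s |-> - ln (1 - s f), whose derivative is f / (1 - s f).
    Polynomials F N serve both for the power series of the logarithm and for the
    traces of powers of a matrix with polynomial entries. *)
Lemma ln_one_sub_of_derivative (R : realType) (f : R) (F : nat -> {poly R})
    (eps : nat -> R) :
  0 <= f < 1 -> eps @ \oo --> (0 : R) ->
  (forall N s, 0 <= s <= 1 ->
     0 <= f / (1 - s * f) - (F N)^`().[s] <= eps N) ->
  (fun N => (F N).[1] - (F N).[0]) @ \oo --> - ln (1 - f).
Proof.
move=> /andP[f0 f1] eps0 Fd.
have sf_gt0 s : 0 <= s <= 1 -> 0 < 1 - s * f by move=> ?; nra.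
have lnD (s : R) : 0 <= s <= 1 ->
    is_derive s 1 (fun t : R => ln (1 - t * f)) ((1 - s * f)^-1 * (- f)).
  move=> s01; apply: (@is_derive1_comp _ (@ln R) (fun t : R => 1 - t * f)).
    by apply: is_derive1_ln; exact: sf_gt0.
  have -> : (fun t : R => 1 - t * f) = horner (1%:P - f *: 'X).
    by apply/funext => t; rewrite !hornerE mulrC.
  apply: is_derive_eq.
  by rewrite derivB derivC derivZ derivX !hornerE; ring.
have bound N : 0 <= - ln (1 - f) - ((F N).[1] - (F N).[0]) <= eps N.
  (* The derivative of g lies between - eps N and 0. *)
  pose g s := (F N).[s] + ln (1 - s * f).
  pose dg s := (F N)^`().[s] + (1 - s * f)^-1 * (- f).
  have gD (s : R) : 0 <= s <= 1 -> is_derive s 1 g (dg s).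
    by move=> s01; have := lnD _ s01 => ?; apply: is_deriveD.
  have [||c c01] := @MVT_segment R g dg 0 1 ler01.
  - move=> s /[!in_itv]/= /andP[s0 s1]; apply: gD.
    by rewrite !ltW.
  - apply: derivable_within_continuous => s /[!in_itv]/= s01.
    by have [] := gD _ s01.
  have /(Fd N) := c01; rewrite /g /dg !mul1r mul0r subr0 ln1 addr0 mulr1.
  by lra.
have -> : - ln (1 - f) = - ln (1 - f) - 0 by rewrite subr0.
have -> : (fun N => (F N).[1] - (F N).[0]) =
    (fun N => - ln (1 - f) - (- ln (1 - f) - ((F N).[1] - (F N).[0]))).
  by apply/funext => N; ring.
apply: cvgB; first exact: cvg_cst.
apply: (squeeze_cvgr _ (cvg_cst 0) eps0).
by near=> N; exact: bound.
Unshelve. all: by end_near. Qed.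

Lemma ln_one_sub_series (R : realType) (f : R) : 0 <= f < 1 ->
  (fun N => \sum_(1 <= k < N) k%:R^-1 * f ^+ k) @ \oo --> - ln (1 - f).
Proof.
move=> f01; have /andP[f0 f1] := f01.
pose F N : {poly R} := \sum_(1 <= k < N) (k%:R^-1 * f ^+ k) *: 'X^k.
have -> : (fun N => \sum_(1 <= k < N) k%:R^-1 * f ^+ k) =
    (fun N => (F N).[1] - (F N).[0]).
  apply/funext => N; rewrite !horner_sum -sumrB; apply: eq_big_nat => k /andP[k1 _].
  by rewrite !hornerE expr1n expr0n gtn_eqF //= mulr0 subr0 mulr1.
(* The remainder (s f)^(N - 1) f / (1 - s f) of a geometric series, at s = 1. *)
pose eps N := f ^+ N.-1 * (f / (1 - f)).
apply: (@ln_one_sub_of_derivative _ f F eps) => //.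
  rewrite -[0 : R](mul0r (f / (1 - f))); apply: cvgMl.
  apply: (@cvg0_shift1 _ (fun n => f ^+ n)).
  by apply: cvg_expr; rewrite ger0_norm.
move=> N s s01.
have sf : 0 < 1 - s * f by nra.
have dF : (F N)^`().[s] = f * \sum_(k < N.-1) (s * f) ^+ k.
  rewrite /F raddf_sum horner_sum big_add1 big_mkord mulr_sumr.
  apply: eq_bigr => k _ /=; rewrite derivZ derivXn hornerZ hornerMn hornerXn.
  rewrite -mulr_natr exprMn exprS /=; field.
  by rewrite -(natrD _ 1) pnatr_eq0.
have -> : f / (1 - s * f) - (F N)^`().[s] = (s * f) ^+ N.-1 * (f / (1 - s * f)).
  rewrite dF; have := subrX1 (s * f) N.-1.
  set S := \sum_(k < _) _ => eS.
  have -> : (s * f) ^+ N.-1 = 1 + (s * f - 1) * S by rewrite -eS; ring.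
  by field; rewrite gt_eqF.
have sf0 : 0 <= s * f by nra.
apply/andP; split; first by rewrite mulr_ge0 ?exprn_ge0 // divr_ge0 // ltW.
have sff : s * f <= f by nra.
apply: ler_pM; rewrite ?exprn_ge0 // ?divr_ge0 //; try exact: ltW.
- by apply: lerXn2r; rewrite ?nnegrE.
- by rewrite ler_wpM2l // lef_pV2 ?posrE //; lra.
Qed.

(** * Neumann series and walks confined to a set *)

Section Neumann.
Context (R : realType) (n : nat) (A : 'M[R]_n).
Hypothesis powA_cvg0 : forall i j, (fun k => (A ^+ k) i j) @ \oo --> (0 : R).

(** A row vector fixed by A is fixed by all its powers, which tend to 0. *)
Lemma unitmx_sub1 : 1%:M - A \in unitmx.
Proof.
rewrite -row_free_unit; apply: inj_row_free => v.
rewrite mulmxBr mulmx1 => /eqP; rewrite subr_eq0 => /eqP vA.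
have vAk k : v = v *m A ^+ k.
  elim: k => [|k IH]; first by rewrite expr0 mulmx1.
  by rewrite exprS mulmxA -vA.
apply/rowP => j; rewrite [RHS]mxE.
have : (fun=> v 0 j) @ \oo --> (0 : R).
  have -> : (fun=> v 0 j) = (fun k => \sum_i v 0 i * (A ^+ k) i j).
    by apply/funext => k; rewrite {1}(vAk k) mxE.
  by apply: cvg0_bigsum => i _; apply: cvg0Mr; exact: powA_cvg0.
by move/cvg_lim; rewrite lim_cst // => <-.
Qed.

Lemma geometric_sum_mx N :
  \sum_(k < N) A ^+ k = invmx (1%:M - A) - A ^+ N *m invmx (1%:M - A).
Proof.
have : (\sum_(k < N) A ^+ k) *m (1%:M - A) = 1%:M - A ^+ N.
  elim: N => [|N IH]; first by rewrite big_ord0 mul0mx expr0 subrr.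
  by rewrite big_ord_recr /= mulmxDl IH mulmxBr mulmx1 exprSr addrA subrK.
move/(congr1 (mulmxr (invmx (1%:M - A)))) => /=.
by rewrite mulmxK ?unitmx_sub1 // mulmxBl mul1mx.
Qed.

End Neumann.

Section Walks.
Context (R : realType) (V : finType).
Implicit Types (Q : V -> V -> R) (W : {set V}).

(** The entries of the powers of [sub_mx Q W], indexed by V whatever W is, so that
    walks in different sets can be compared. *)
Fixpoint walk Q W n x y : R :=
  if n is k.+1 then (x \in W)%:R * \sum_z Q x z * walk Q W k z y
  else ((x == y) && (y \in W))%:R.

Lemma walk_notinl Q W n x y : x \notin W -> walk Q W n x y = 0.
Proof.
case: n => [|n] xW /=; last by rewrite (negPf xW) mul0r.
by case: eqP => // <-; rewrite (negPf xW).
Qed.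

Lemma walk_notinr Q W n x y : y \notin W -> walk Q W n x y = 0.
Proof.
move=> yW; elim: n x => [|n IH] x /=; first by rewrite (negPf yW) andbF.
by rewrite big1 ?mulr0 // => z _; rewrite IH mulr0.
Qed.

Lemma walk_ge0 Q W n x y : (forall u v, 0 <= Q u v) -> 0 <= walk Q W n x y.
Proof.
move=> Q0; elim: n x => [|n IH] x /=; first exact: ler0n.
by rewrite mulr_ge0 ?ler0n // sumr_ge0 // => z _; rewrite mulr_ge0.
Qed.

Lemma le_walk Q Q' W W' n x y :
  (forall u v, 0 <= Q' u v <= Q u v) -> W' \subset W ->
  walk Q' W' n x y <= walk Q W n x y.
Proof.
move=> Q'Q W'W.
have Q'0 u v : 0 <= Q' u v by have /andP[] := Q'Q u v.
have W'WR u : (u \in W')%:R <= (u \in W)%:R :> R.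
  by case: (boolP (u \in W')) => [/(subsetP W'W) ->|_] //; exact: ler0n.
elim: n x => [|n IH] x /=; first by case: (x == y); [exact: W'WR|].
apply: ler_pM => //; first by rewrite sumr_ge0 // => z _; rewrite mulr_ge0 ?walk_ge0.
apply: ler_sum => z _; apply: ler_pM => //; first exact: walk_ge0.
by have /andP[] := Q'Q x z.
Qed.

Lemma sum_set_enum W (F : V -> R) :
  (forall x, x \notin W -> F x = 0) -> \sum_x F x = \sum_(i < #|W|) F (enum_val i).
Proof.
move=> F0; rewrite -(big_enum_val F) /=.
rewrite (bigID (mem W)) /= [X in _ + X]big1 ?addr0 //.
Qed.

Lemma walkE Q W n i j :
  (sub_mx Q W ^+ n) i j = walk Q W n (enum_val i) (enum_val j).
Proof.
elim: n i => [|n IH] i.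
  by rewrite expr0 mxE /= (inj_eq enum_val_inj) enum_valP andbT.
rewrite exprS mxE /= enum_valP mul1r.
rewrite (@sum_set_enum W) => [|x xW]; last by rewrite walk_notinl // mulr0.
by apply: eq_bigr => k _; rewrite mxE IH.
Qed.

Lemma mxtrace_sub_mx Q W n : \tr (sub_mx Q W ^+ n) = \sum_x walk Q W n x x.
Proof.
rewrite (@sum_set_enum W) => [|x xW]; last by rewrite walk_notinl.
by apply: eq_bigr => i _; rewrite walkE.
Qed.

Lemma walkSr Q W n x y :
  walk Q W n.+1 x y = (y \in W)%:R * \sum_z walk Q W n x z * Q z y.
Proof.
elim: n x => [|n IH] x.
  rewrite /= (bigD1 y) //= eqxx /= big1 ?addr0; last first.
    by move=> z /negPf ->; rewrite mulr0.
  rewrite (bigD1 x) //= eqxx /= big1 ?addr0; last first.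
    by move=> z; rewrite eq_sym => /negPf ->; rewrite mul0r.
  by ring.
rewrite [LHS]/= [in RHS]/=.
under eq_bigr do rewrite -/(walk Q W n.+1 _ y) IH mulrCA mulr_sumr.
rewrite -mulr_sumr exchange_big /= mulrCA; congr (_ * _); rewrite mulr_sumr.
apply: eq_bigr => z _; rewrite -mulrA mulr_suml; congr (_ * _).
by apply: eq_bigr => t _; rewrite mulrA.
Qed.

End Walks.

(** * The Green's function *)

Section Green.
Context (R : realType) (V : finType).
Implicit Types (Q : V -> V -> R) (W : {set V}).

(** The Green's function as the partition function of two Dirac masses: it is
    indexed by V, and it vanishes as soon as an argument is outside W. *)
Definition green Q W x y : R :=
  Zpart Q (fun u => (u == x)%:R) (fun u => (u == y)%:R) W.

Lemma ZpartE Q a b W : Zpart Q a b W =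
  \sum_i \sum_j a (enum_val i) * invmx (1%:M - sub_mx Q W) i j * b (enum_val j).
Proof.
rewrite /Zpart mxE exchange_big /=; apply: eq_bigr => j _.
rewrite mxE mulr_suml; apply: eq_bigr => i _.
by rewrite !mxE.
Qed.

Lemma green_enum_val Q W i j :
  green Q W (enum_val i) (enum_val j) = invmx (1%:M - sub_mx Q W) i j.
Proof.
rewrite /green ZpartE (bigD1 i) //= [X in _ + X]big1 ?addr0; last first.
  move=> k ki; rewrite big1 // => l _.
  by rewrite (inj_eq enum_val_inj) (negPf ki) !mul0r.
rewrite (bigD1 j) //= big1 ?addr0; last first.
  by move=> k kj; rewrite (inj_eq enum_val_inj k) (negPf kj) !mulr0.
by rewrite !eqxx mul1r mulr1.
Qed.

Lemma green_notinl Q W x y : x \notin W -> green Q W x y = 0.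
Proof.
move=> xW; rewrite /green ZpartE big1 // => i _; rewrite big1 // => j _.
case: eqP => [e|]; last by rewrite !mul0r.
by rewrite -e enum_valP in xW.
Qed.

Lemma green_notinr Q W x y : y \notin W -> green Q W x y = 0.
Proof.
move=> yW; rewrite /green ZpartE big1 // => i _; rewrite big1 // => j _.
case: (_ =P y) => [e|]; last by rewrite !mulr0.
by rewrite -e enum_valP in yW.
Qed.

Lemma Zpart_green Q a b W :
  Zpart Q a b W = \sum_x \sum_y a x * green Q W x y * b y.
Proof.
rewrite ZpartE (@sum_set_enum _ _ W) => [|x xW]; last first.
  by rewrite big1 // => y _; rewrite green_notinl // mulr0 mul0r.
apply: eq_bigr => i _; rewrite (@sum_set_enum _ _ W) => [|y yW]; last first.
  by rewrite green_notinr // mulr0 mul0r.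
by apply: eq_bigr => j _; rewrite green_enum_val.
Qed.

Lemma eq_green Q Q' W x y :
  {in W &, forall u v, Q u v = Q' u v} -> green Q W x y = green Q' W x y.
Proof.
move=> QQ'; rewrite /green /Zpart; suff -> : sub_mx Q W = sub_mx Q' W by [].
by apply/matrixP => i j; rewrite !mxE QQ' // enum_valP.
Qed.

(** The form in which the assumption on the spectral radius is used: as [walk] is
    monotone in the kernel and in the set, it passes to smaller kernels and to
    subsets of V. *)
Definition transient Q : Prop := (forall x y, 0 <= Q x y) /\
  forall x y, (fun n => walk Q [set: V] n x y) @ \oo --> (0 : R).

Lemma transient_le Q Q' :
  transient Q -> (forall x y, 0 <= Q' x y <= Q x y) -> transient Q'.
Proof.
move=> [Q0 Qc] Q'Q; have Q'0 x y : 0 <= Q' x y by have /andP[] := Q'Q x y.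
split=> // x y; apply: (squeeze_cvgr _ (cvg_cst 0) (Qc x y)).
by near=> n; rewrite walk_ge0 //= le_walk.
Unshelve. all: by end_near. Qed.

Section Transient.
Variable Q : V -> V -> R.
Hypothesis trQ : transient Q.
Let Q0 : forall x y, 0 <= Q x y := proj1 trQ.

Lemma walk_cvg0 W x y : (fun n => walk Q W n x y) @ \oo --> (0 : R).
Proof.
apply: (squeeze_cvgr _ (cvg_cst 0) (proj2 trQ x y)).
near=> n; rewrite walk_ge0 //= le_walk // => u v; by rewrite lexx andbT.
Unshelve. all: by end_near. Qed.

Lemma sub_mx_pow_cvg0 W i j : (fun n => (sub_mx Q W ^+ n) i j) @ \oo --> (0 : R).
Proof. by under eq_fun do rewrite walkE; exact: walk_cvg0. Qed.

Lemma sum_walk W N x y : \sum_(k < N) walk Q W k x y =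
  green Q W x y - \sum_z walk Q W N x z * green Q W z y.
Proof.
have [xW|xW] := boolP (x \in W); last first.
  rewrite green_notinl // !big1 ?subr0 // => z _.
    by rewrite walk_notinl // mul0r.
  by rewrite walk_notinl.
have [yW|yW] := boolP (y \in W); last first.
  rewrite green_notinr // !big1 ?subr0 // => z _.
    by rewrite green_notinr // mulr0.
  by rewrite walk_notinr.
rewrite -(enum_rankK_in xW xW) -(enum_rankK_in yW yW).
set i := enum_rank_in xW x; set j := enum_rank_in yW y.
have := geometric_sum_mx (@sub_mx_pow_cvg0 W) N => /matrixP/(_ i j).
rewrite summxE !mxE -green_enum_val.
under eq_bigr do rewrite walkE.
move=> ->; congr (_ - _); rewrite (@sum_set_enum _ _ W) => [|z zW]; last first.
  by rewrite walk_notinr // mul0r.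
by apply: eq_bigr => k _; rewrite walkE green_enum_val.
Qed.

Lemma walk_green_cvg0 W x y :
  (fun N => \sum_z walk Q W N x z * green Q W z y) @ \oo --> (0 : R).
Proof.
apply: cvg0_bigsum => z _; under eq_fun do rewrite mulrC.
by apply: cvg0Mr; exact: walk_cvg0.
Qed.

Lemma sum_walk_cvg W x y :
  (fun N => \sum_(k < N) walk Q W k x y) @ \oo --> green Q W x y.
Proof.
under eq_fun do rewrite sum_walk.
have : (fun=> green Q W x y) @ \oo --> green Q W x y by exact: cvg_cst.
by move=> /cvgB /(_ (@walk_green_cvg0 W x y)); rewrite subr0.
Qed.

Lemma sum_walk_le_green W N x y : \sum_(k < N) walk Q W k x y <= green Q W x y.
Proof.
apply: (@cvgr_to_ge _ \oo _ _ _ _ _ (@sum_walk_cvg W x y)).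
near=> M; have NM : (N <= M)%N by near: M; exact: nbhs_infty_ge.
rewrite -(subnKC NM) big_split_ord /= lerDl sumr_ge0 // => k _.
exact: walk_ge0.
Unshelve. all: by end_near. Qed.

Lemma green_ge0 W x y : 0 <= green Q W x y.
Proof. by have := @sum_walk_le_green W 0 x y; rewrite big_ord0. Qed.

Lemma green_stepl W x y : green Q W x y =
  ((x == y) && (y \in W))%:R + (x \in W)%:R * \sum_z Q x z * green Q W z y.
Proof.
apply: (cvgn_unique (cvgn_shiftS (@sum_walk_cvg W x y))).
have -> : (fun n => \sum_(k < n.+1) walk Q W k x y) = (fun n =>
    ((x == y) && (y \in W))%:R +
    (x \in W)%:R * \sum_z Q x z * \sum_(i < n) walk Q W i z y).
  apply/funext => n; rewrite big_ord_recl; congr (_ + _).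
  rewrite /= -mulr_sumr exchange_big /=; congr (_ * _).
  by apply: eq_bigr => z _; rewrite mulr_sumr.
apply: cvgD; first exact: cvg_cst.
apply: cvgMr; apply: (@cvg_bigsum _ _ _ _
  (fun n z => Q x z * \sum_(i < n) walk Q W i z y) (fun z => Q x z * green Q W z y)).
by move=> z _; apply: cvgMr; exact: sum_walk_cvg.
Qed.

Lemma green_stepr W x y : green Q W x y =
  ((x == y) && (y \in W))%:R + (y \in W)%:R * \sum_z green Q W x z * Q z y.
Proof.
apply: (cvgn_unique (cvgn_shiftS (@sum_walk_cvg W x y))).
have -> : (fun n => \sum_(k < n.+1) walk Q W k x y) = (fun n =>
    ((x == y) && (y \in W))%:R +
    (y \in W)%:R * \sum_z (\sum_(i < n) walk Q W i x z) * Q z y).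
  apply/funext => n; rewrite big_ord_recl; congr (_ + _).
  under eq_bigr do rewrite walkSr.
  rewrite -mulr_sumr exchange_big /=; congr (_ * _).
  by apply: eq_bigr => z _; rewrite mulr_suml.
apply: cvgD; first exact: cvg_cst.
apply: cvgMr; apply: (@cvg_bigsum _ _ _ _
  (fun n z => (\sum_(i < n) walk Q W i x z) * Q z y) (fun z => green Q W x z * Q z y)).
by move=> z _; apply: cvgMl; exact: sum_walk_cvg.
Qed.

(** The linear equation (1 - Q_W) v = w is solved by the Green's function; it turns
    one-step equations into last-exit or first-entrance decompositions. *)
Lemma green_solves W (v w : V -> R) :
  {in W, forall y, v y = w y + \sum_(u in W) Q y u * v u} ->
  {in W, forall y, v y = \sum_u green Q W y u * w u}.
Proof.
move=> vw y yW.
have wE u : green Q W y u * w u =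
    green Q W y u * v u - \sum_(t in W) green Q W y u * Q u t * v t.
  have [uW|uW] := boolP (u \in W); last first.
    by rewrite green_notinr // !mul0r big1 ?subrr // => t _; rewrite !mul0r.
  rewrite (vw u uW) mulrDr mulr_sumr.
  under [X in _ = _ + X - _]eq_bigr do rewrite mulrA.
  by rewrite addrK.
under eq_bigr do rewrite wE.
rewrite sumrB exchange_big /=.
have -> : \sum_(i : V) green Q W y i * v i = \sum_(t in W) green Q W y t * v t.
  rewrite (bigID (mem W)) /= [X in _ + X]big1 ?addr0 // => t tW.
  by rewrite green_notinr // mul0r.
have step t : t \in W -> green Q W y t * v t -
    \sum_i green Q W y i * Q i t * v t = (y == t)%:R * v t.
  move=> tW; have := green_stepr W y t; rewrite tW andbT mul1r => ->.
  by rewrite -mulr_suml; ring.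
rewrite -sumrB (bigD1 y) //= step // eqxx mul1r big1 ?addr0 //.
by move=> t /andP[tW ty]; rewrite step // eq_sym (negPf ty) mul0r.
Qed.

End Transient.

Lemma le_green Q Q' W x y : transient Q ->
  (forall u v, 0 <= Q' u v <= Q u v) -> green Q' W x y <= green Q W x y.
Proof.
move=> trQ Q'Q; have trQ' := transient_le trQ Q'Q.
apply: (@cvgr_to_le _ \oo _ _ _ _ _ (@sum_walk_cvg _ trQ' W x y)).
near=> N; apply: le_trans (sum_walk_le_green trQ W N x y).
by apply: ler_sum => k _; exact: le_walk.
Unshelve. all: by end_near. Qed.

End Green.

(** * Removing a point *)

Section Removal.
Context (R : realType) (V : finType).
Implicit Types (Q : V -> V -> R) (U W : {set V}).

(** If x is not in U: the weight of the paths from y which move in U until they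
    step to x, and stop there. *)
Definition entrance Q U x y : R := (y == x)%:R + \sum_u green Q U y u * Q u x.
(** If x is not in U: the weight of the paths from x to z which stay in U
    after their first point. *)
Definition departure Q U x z : R := (z == x)%:R + \sum_v Q x v * green Q U v z.
(** If x is not in U: the weight of the excursions from x through U back to x. *)
Definition return_mass Q U x : R := \sum_v Q x v * entrance Q U x v.

Section Transient.
Variable Q : V -> V -> R.
Hypothesis trQ : transient Q.
Let Q0 : forall x y, 0 <= Q x y := proj1 trQ.

Lemma entrance_ge0 U x y : 0 <= entrance Q U x y.
Proof.
by rewrite addr_ge0 ?ler0n // sumr_ge0 // => u _; rewrite mulr_ge0 // green_ge0.
Qed.

Lemma return_mass_ge0 U x : 0 <= return_mass Q U x.
Proof. by rewrite sumr_ge0 // => v _; rewrite mulr_ge0 // entrance_ge0. Qed.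

Lemma entrance_notin U x y : y != x -> y \notin U -> entrance Q U x y = 0.
Proof.
move=> /negPf yx yU; rewrite /entrance yx add0r big1 // => u _.
by rewrite green_notinl // mul0r.
Qed.

Variables (W : {set V}) (x : V).
Hypothesis xW : x \in W.
Let W' := W :\ x.

Let xW' : x \notin W'. Proof. by rewrite !inE eqxx. Qed.

(** A path from y to z in W either avoids x or is cut at its first visit to x. *)
Lemma green_removal y z :
  green Q W y z = green Q W' y z + entrance Q W' x y * green Q W x z.
Proof.
have [zW|zW] := boolP (z \in W); last first.
  rewrite !(@green_notinr _ _ Q _ _ z) //; first by rewrite mulr0 addr0.
  by rewrite !inE (negPf zW) andbF.
have [->|yx] := eqVneq y x.
  rewrite (green_notinl _ _ xW') /entrance eqxx big1 => [|u _]; first by rewrite /=; ring.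
  by rewrite green_notinl // mul0r.
have [yW|yW] := boolP (y \in W); last first.
  have yW' : y \notin W' by rewrite !inE (negPf yW) andbF.
  by rewrite (green_notinl _ _ yW) (green_notinl _ _ yW') entrance_notin //; ring.
have yW' : y \in W' by rewrite !inE yx.
rewrite (@green_solves _ _ Q trQ W' (green Q W ^~ z)
  (fun u => (u == z)%:R + Q u x * green Q W x z)) //; last first.
  move=> u uW'; have uW : u \in W by move: uW'; rewrite inE => /andP[].
  rewrite green_stepl // zW andbT uW mul1r -addrA; congr (_ + _).
  rewrite (bigD1 x) //=; congr (_ + _).
  rewrite (bigID (mem W')) /= [X in _ + X]big1 ?addr0 => [|v /andP[vx vW']].
    by apply: eq_bigl => v; rewrite !inE; case: (v == x).
  by rewrite green_notinl ?mulr0 //; move: vW'; rewrite !inE vx.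
have -> : entrance Q W' x y = \sum_u green Q W' y u * Q u x.
  by rewrite /entrance (negPf yx) add0r.
rewrite mulr_suml.
under eq_bigr do rewrite mulrDr mulrA.
rewrite big_split /=; congr (_ + _).
rewrite (bigD1 z) //= eqxx mulr1 big1 ?addr0 // => u /negPf ->.
by rewrite mulr0.
Qed.

(** A path from x either never comes back to x or is cut at its first return. *)
Lemma green_first_departure z :
  green Q W x z = departure Q W' x z + return_mass Q W' x * green Q W x z.
Proof.
have [zW|zW] := boolP (z \in W); last first.
  have zx : z != x by apply: contraNneq zW => ->.
  rewrite green_notinr // mulr0 addr0 /departure (negPf zx) add0r big1 // => v _.
  by rewrite green_notinr ?mulr0 // !inE (negPf zW) andbF.
rewrite {1}green_stepl // xW zW andbT mul1r /departure eq_sym -addrA; congr (_ + _).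
rewrite mulr_suml -big_split; apply: eq_bigr => v _ /=.
by rewrite green_removal; ring.
Qed.

Lemma departure_self : departure Q W' x x = 1.
Proof.
rewrite /departure eqxx big1 ?addr0 // => v _.
by rewrite green_notinr // mulr0.
Qed.

(** For z = x, [green_first_departure] reads (1 - f) G = 1 with G >= 0. *)
Lemma return_mass_lt1 : return_mass Q W' x < 1.
Proof.
have := green_first_departure x; rewrite departure_self.
have := green_ge0 trQ W x x.
set g := green _ _ _ _; set f := return_mass _ _ _ => g0 e.
have {e} e : (1 - f) * g = 1 by rewrite mulrBl mul1r {1}e; ring.
rewrite ltNge; apply/negP => f1.
have : (1 - f) * g <= 0 by rewrite mulr_le0_ge0 ?subr_le0.
by rewrite e ler10.
Qed.

Lemma green_departure z :
  green Q W x z = departure Q W' x z / (1 - return_mass Q W' x).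
Proof.
have e := green_first_departure z; have f1 := return_mass_lt1.
apply: (canRL (mulfK _)); first by rewrite subr_eq0 gt_eqF.
by rewrite mulrBr mulr1 {1}e; ring.
Qed.

Lemma green_self : green Q W x x = (1 - return_mass Q W' x)^-1.
Proof. by rewrite green_departure departure_self div1r. Qed.

End Transient.
End Removal.

(** * The mass of the loops through a point *)

Section MatrixDerivative.
Context (R : comNzRingType) (m : nat).
Implicit Types A B : 'M[{poly R}]_m.

Lemma map_deriv_mulmx A B : map_mx (@deriv R) (A *m B) =
  map_mx (@deriv R) A *m B + A *m map_mx (@deriv R) B.
Proof.
apply/matrixP => i j; rewrite !mxE raddf_sum -big_split.
by apply: eq_bigr => k _; rewrite !mxE /= derivM.
Qed.

Lemma deriv_mxtrace A : (\tr A)^`() = \tr (map_mx (@deriv R) A).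
Proof. by rewrite raddf_sum; apply: eq_bigr => i _; rewrite mxE. Qed.

(** The factors of a power of A do not commute with the derivative of A, but they
    can be rotated under the trace. *)
Lemma deriv_mxtrace_exp A n :
  (\tr (A ^+ n.+1))^`() = n.+1%:R * \tr (A ^+ n *m map_mx (@deriv R) A).
Proof.
suff gen k : \tr (A ^+ k *m map_mx (@deriv R) (A ^+ n.+1)) =
    n.+1%:R * \tr (A ^+ (k + n) *m map_mx (@deriv R) A).
  by rewrite deriv_mxtrace -[map_mx _ _]mul1mx (gen 0).
elim: n k => [|n IH] k; first by rewrite addn0 expr1 mul1r.
rewrite exprS map_deriv_mulmx mulmxDr mxtraceD.
have -> : A ^+ k *m (A *m map_mx (@deriv R) (A ^+ n.+1)) =
    A ^+ k.+1 *m map_mx (@deriv R) (A ^+ n.+1) by rewrite (exprSr A k) mulmxA.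
rewrite IH mulmxA mxtrace_mulC mulmxA.
have -> : A ^+ n.+1 *m A ^+ k = A ^+ (k + n.+1) by rewrite addnC (exprD A n.+1 k).
by rewrite addSnnS -[in RHS]natr1 mulrDl mul1r addrC.
Qed.

End MatrixDerivative.

Section LoopMeasure.
Context (R : realType) (V : finType).
Implicit Types (Q : V -> V -> R) (U W : {set V}).

Definition closed_walks Q W n : R := \sum_x walk Q W n x x.

Definition loop_partial Q W N : R :=
  \sum_(1 <= n < N) n%:R^-1 * closed_walks Q W n.

Definition loop_total Q W : R := limn (loop_partial Q W).

(** Dropping the factors 1 / n bounds the partial sums by the trace of the
    Green's function. *)
Lemma loop_partial_cvg Q W : transient Q ->
  loop_partial Q W @ \oo --> loop_total Q W.
Proof.
move=> trQ; have Q0 := proj1 trQ.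
have c0 n : 0 <= closed_walks Q W n by rewrite sumr_ge0 // => x _; exact: walk_ge0.
apply: nondecreasing_is_cvgn.
  apply/nondecreasing_seqP => n; rewrite /loop_partial.
  case: n => [|n]; first by rewrite !big_geq.
  by rewrite [leRHS]big_nat_recr //= lerDl mulr_ge0 ?invr_ge0.
exists (\sum_x green Q W x x) => _ [N _ <-].
apply: (@le_trans _ _ (\sum_(n < N) closed_walks Q W n)).
  rewrite /loop_partial -(big_mkord xpredT).
  case: N => [|N]; first by rewrite !big_geq.
  rewrite [leRHS]big_ltn // -[leLHS]add0r lerD // ler_sum_nat // => n /andP[n1 _].
  by rewrite ler_piMl // invf_le1 ?ltr0n // ler1n.
rewrite exchange_big /=; apply: ler_sum => x _.
exact: sum_walk_le_green.
Qed.

Section RowScaling.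
Variable Q : V -> V -> R.
Hypothesis trQ : transient Q.
Let Q0 : forall x y, 0 <= Q x y := proj1 trQ.
Variables (W : {set V}) (x : V).
Hypothesis xW : x \in W.
Let W' := W :\ x.
Let ret := return_mass Q W' x.

Let xW' : x \notin W'. Proof. by rewrite !inE eqxx. Qed.

Definition scale_row (s : R) u v : R := (if u == x then s else 1) * Q u v.

(** The kernel [scale_row s] with s an indeterminate, for differentiating in s. *)
Definition scaled_mx : 'M[{poly R}]_#|W| :=
  \matrix_(i, j) ((if enum_val i == x then 'X else 1) *
                  (Q (enum_val i) (enum_val j))%:P).

Let scale_row1 : scale_row 1 = Q.
Proof. by apply/funext => u; apply/funext => v; rewrite /scale_row if_same mul1r. Qed.

Let scale_row_le s u v : 0 <= s <= 1 -> 0 <= scale_row s u v <= Q u v.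
Proof.
move=> /andP[s0 s1]; rewrite /scale_row; have := Q0 u v.
by case: ifP => _ q0; apply/andP; split; nra.
Qed.

Let scale_row_transient s : 0 <= s <= 1 -> transient (scale_row s).
Proof. by move=> s01; apply: (transient_le trQ) => u v; exact: scale_row_le. Qed.

Let horner_scaled_mx s n :
  map_mx (horner_eval s) (scaled_mx ^+ n) = sub_mx (scale_row s) W ^+ n.
Proof.
elim: n => [|n IH]; first by rewrite !expr0 map_mx1.
rewrite !exprS map_mxM IH; congr (_ *m _).
apply/matrixP => i j; rewrite /scaled_mx !mxE /= /horner_eval hornerM hornerC /scale_row.
by case: ifP => _; rewrite ?hornerX ?hornerC.
Qed.

Let horner_trace s n :
  (\tr (scaled_mx ^+ n)).[s] = closed_walks (scale_row s) W n.
Proof.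
rewrite /closed_walks -mxtrace_sub_mx -horner_scaled_mx.
by rewrite trace_map_mx.
Qed.

Let horner_trace_deriv s n :
  (\tr (scaled_mx ^+ n *m map_mx (@deriv R) scaled_mx)).[s] =
  \sum_v Q x v * walk (scale_row s) W n v x.
Proof.
have -> (p : {poly R}) : p.[s] = horner_eval s p by [].
rewrite -trace_map_mx map_mxM horner_scaled_mx.
rewrite (@sum_set_enum _ _ W) => [|v vW]; last by rewrite walk_notinl // mulr0.
apply: eq_bigr => i _; rewrite mxE.
have := enum_rankK_in xW xW; set i0 := enum_rank_in xW x => ei0.
rewrite (bigD1 i0) //= big1 ?addr0 => [|j ji0]; rewrite walkE /scaled_mx !mxE /= /horner_eval.
  by rewrite ei0 eqxx derivM derivX derivC mulr0 addr0 mul1r hornerC mulrC.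
rewrite -ei0 (inj_eq enum_val_inj) (negPf ji0).
by rewrite derivM derivC derivC mul0r mulr0 addr0 horner0 mulr0.
Qed.

Let walk_scale0 n y z : z != x ->
  walk (scale_row 0) W n y z = walk Q W' n y z.
Proof.
move=> zx; elim: n y => [|n IH] y /=; first by rewrite !inE zx.
rewrite !inE; have [->|yx] := eqVneq y x.
  rewrite mul0r big1 ?mulr0 // => v _.
  by rewrite /scale_row eqxx !mul0r.
by congr (_ * _); apply: eq_bigr => v _; rewrite IH /scale_row (negPf yx) mul1r.
Qed.

Let closed_walks_scale0 n :
  closed_walks (scale_row 0) W n.+1 = closed_walks Q W' n.+1.
Proof.
apply: eq_bigr => y _; have [->|yx] := eqVneq y x; last exact: walk_scale0.
rewrite [RHS]walk_notinl //= big1 ?mulr0 // => v _.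
by rewrite /scale_row eqxx !mul0r.
Qed.

Let green_scaled s v : 0 <= s <= 1 ->
  green (scale_row s) W v x = entrance Q W' x v / (1 - s * ret).
Proof.
move=> s01; have trs := scale_row_transient s01.
have greenW' y z : green (scale_row s) W' y z = green Q W' y z.
  apply: eq_green => u w; rewrite !inE => /andP[/negPf ux _] _.
  by rewrite /scale_row ux mul1r.
have entrE y : entrance (scale_row s) W' x y = entrance Q W' x y.
  rewrite /entrance; congr (_ + _); apply: eq_bigr => u _; rewrite greenW'.
  have [->|ux] := eqVneq u x; first by rewrite green_notinr // !mul0r.
  by rewrite /scale_row (negPf ux) mul1r.
rewrite (green_removal trs W x) (green_notinr _ _ xW') add0r (green_self trs xW).
rewrite entrE; congr (_ / (1 - _)).
rewrite /ret /return_mass mulr_sumr; apply: eq_bigr => u _.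
by rewrite entrE /scale_row eqxx mulrA.
Qed.

(** Multiply the row of x by s. By [deriv_mxtrace_exp] the factor 1 / n of the loop
    mass cancels in the derivative, leaving the weight of the excursions out of x
    followed by walks of bounded length back to x; in the limit this is
    f / (1 - s f). The error is largest at s = 1, where it is the remainder of a
    convergent Neumann series. At s = 1 the loops in W are counted, at s = 0 only
    those avoiding x. *)
Lemma loop_total_removal : loop_total Q W - loop_total Q W' = - ln (1 - ret).
Proof.
pose F N : {poly R} := \sum_(1 <= n < N) n%:R^-1 *: \tr (scaled_mx ^+ n).
(* The remainder of the Neumann series at s = 1, after a first step out of x.
   Its length is N - 1 since the loops of length at least 1 and less than N are
   left with 0 to N - 2 steps once their step out of x is taken away. *)
pose eps N := \sum_v Q x v * \sum_z walk Q W N.-1 v z * green Q W z x.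
have FE s N : (F N).[s] = loop_partial (scale_row s) W N.
  by rewrite horner_sum; apply: eq_bigr => n _; rewrite hornerZ horner_trace.
have FD : (fun N => (F N).[1] - (F N).[0]) =
          (fun N => loop_partial Q W N - loop_partial Q W' N).
  apply/funext => N; rewrite !FE scale_row1; congr (_ - _).
  by apply: eq_big_nat => -[|n] // _; rewrite closed_walks_scale0.
have dF N s : (F N)^`().[s] =
    \sum_v Q x v * \sum_(k < N.-1) walk (scale_row s) W k v x.
  rewrite /F raddf_sum horner_sum big_add1 big_mkord.
  under [RHS]eq_bigr do rewrite mulr_sumr.
  rewrite exchange_big; apply: eq_bigr => k _ /=.
  rewrite derivZ hornerZ deriv_mxtrace_exp hornerM horner_trace_deriv.
  by rewrite -polyC_natr hornerC mulKf // pnatr_eq0.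
apply: (@cvgn_unique _ (fun N => loop_partial Q W N - loop_partial Q W' N)).
  by apply: cvgB; exact: loop_partial_cvg.
rewrite -FD; apply: (@ln_one_sub_of_derivative _ ret F eps).
- by rewrite return_mass_ge0 //= return_mass_lt1.
- apply: (@cvg0_shift1 _ (fun N => \sum_v Q x v * \sum_z walk Q W N v z * green Q W z x)).
  by apply: cvg0_bigsum => v _; apply: cvg0Mr; exact: walk_green_cvg0.
move=> N s s01; have trs := scale_row_transient s01.
have -> : ret / (1 - s * ret) - (F N)^`().[s] =
    \sum_v Q x v * \sum_z walk (scale_row s) W N.-1 v z * green (scale_row s) W z x.
  rewrite dF {1}/ret /return_mass mulr_suml -sumrB; apply: eq_bigr => v _.
  by rewrite (sum_walk trs) green_scaled //; ring.
apply/andP; split.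
  rewrite sumr_ge0 // => v _; rewrite mulr_ge0 // sumr_ge0 // => z _.
  by rewrite mulr_ge0 ?green_ge0 // walk_ge0 // => *; exact: (proj1 trs).
apply: ler_sum => v _; rewrite ler_wpM2l //; apply: ler_sum => z _.
apply: ler_pM; rewrite ?green_ge0 ?walk_ge0 //; first exact: (proj1 trs).
  by apply: le_walk => // *; exact: scale_row_le.
by apply: le_green => // *; exact: scale_row_le.
Qed.

End RowScaling.
End LoopMeasure.

(** * The cone of nonnegative solutions *)

Section Cone.
Context (R : realType) (V : finType) (L : {set V} -> R) (lambda : R).
Implicit Types (S T U W : {set V}) (g h : {set V} -> R).

Definition weight S U : R := expR (lambda * (L U - L (U :\: S))).

(** Membership is tested on the subsets of W only, which is what the induction on W
    provides. *)
Definition in_cone W g : Prop := exists2 p : {set V} -> R,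
  forall S, 0 <= p S &
  forall U, U \subset W -> g U = \sum_(S : {set V} | S \subset U) p S * weight S U.

Lemma in_cone_eq W g h :
  (forall U, U \subset W -> g U = h U) -> in_cone W g -> in_cone W h.
Proof. by move=> gh [p p0 gE]; exists p => // U UW; rewrite -gh // gE. Qed.

Lemma in_cone_cst W c : 0 <= c -> in_cone W (fun=> c).
Proof.
move=> c0; exists (fun S => if S == set0 then c else 0) => [S|U _].
  by case: ifP.
rewrite (bigD1 set0) ?sub0set //= eqxx big1 ?addr0 => [|S /andP[_ /negPf ->]].
  by rewrite /weight setD0 subrr mulr0 expR0 mulr1.
by rewrite mul0r.
Qed.

Lemma in_coneD W g h :
  in_cone W g -> in_cone W h -> in_cone W (fun U => g U + h U).
Proof.
move=> [p p0 gE] [q q0 hE]; exists (fun S => p S + q S) => [S|U UW].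
  exact: addr_ge0.
rewrite gE // hE // -big_split; apply: eq_bigr => S _.
by rewrite mulrDl.
Qed.

Lemma in_coneZ W c g : 0 <= c -> in_cone W g -> in_cone W (fun U => c * g U).
Proof.
move=> c0 [p p0 gE]; exists (fun S => c * p S) => [S|U UW]; first exact: mulr_ge0.
by rewrite gE // mulr_sumr; apply: eq_bigr => S _; rewrite mulrA.
Qed.

(** The system is triangular, so the coefficients of u n are determined from the
    values of u n by recursion on the set, and converge with them. *)
Lemma in_cone_lim W (u : nat -> {set V} -> R) g :
  (forall n, in_cone W (u n)) ->
  (forall U, U \subset W -> u ^~ U @ \oo --> g U) -> in_cone W g.
Proof.
move=> uW ug.
have /choice[p pP] : forall n, exists p : {set V} -> R,
    (forall S, 0 <= p S) /\ forall U, U \subset W ->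
    u n U = \sum_(S : {set V} | S \subset U) p S * weight S U.
  by move=> n; have [p p0 pE] := uW n; exists p.
have p_cvg S : S \subset W -> cvgn (p ^~ S).
  have [n] := ubnP #|S|; elim: n S => // n IH S /ltnSE Sn SW.
  (* The equation at S, solved for the coefficient at S. *)
  have pE k : p k S = (u k S - \sum_(T : {set V} | T \proper S) p k T * weight T S)
                      / weight S S.
    rewrite (proj2 (pP k) S SW) (bigD1 S) //=.
    have -> : \sum_(T : {set V} | (T \subset S) && (T != S)) p k T * weight T S =
        \sum_(T : {set V} | T \proper S) p k T * weight T S.
      by apply: eq_bigl => T; rewrite properEneq andbC.
    by rewrite addrK mulfK // gt_eqF // expR_gt0.
  apply/cvg_ex; exists ((g S - \sum_(T : {set V} | T \proper S)
    limn (p ^~ T) * weight T S) / weight S S).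
  under eq_fun do rewrite pE.
  apply: cvgMl; apply: cvgB; first exact: ug.
  apply: (@cvg_bigsum _ _ _ _ (fun k T => p k T * weight T S)
    (fun T => limn (p ^~ T) * weight T S)) => T TS.
  apply: cvgMl; apply: IH; last exact: subset_trans (proper_sub TS) SW.
  exact: leq_trans (proper_card TS) Sn.
exists (fun S => if S \subset W then limn (p ^~ S) else 0) => [S|U UW].
  case: ifP => // SW; apply: limr_ge; first exact: p_cvg.
  by near=> k; exact: (proj1 (pP k)).
apply: (cvgn_unique (ug U UW)).
under eq_fun do rewrite (proj2 (pP _) U UW).
apply: (@cvg_bigsum _ _ _ _ (fun k S => p k S * weight S U)
  (fun S => (if S \subset W then limn (p ^~ S) else 0) * weight S U)) => S SU.
have SW := subset_trans SU UW; rewrite SW.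
by apply: cvgMl; exact: p_cvg.
Unshelve. all: by end_near. Qed.

(** For x in U, the factor exp (lambda (L(U) - L(U \ x))) times weight S (U \ x) is
    weight (x |: S) U: the two differences of L telescope. *)
Lemma in_cone_insert W x g : x \in W -> in_cone (W :\ x) g ->
  in_cone W (fun U => if x \in U then
    expR (lambda * (L U - L (U :\ x))) * g (U :\ x) else 0).
Proof.
move=> xW [p p0 gE]; exists (fun S => if x \in S then p (S :\ x) else 0) => [S|U UW].
  by case: ifP.
have [xU|xU] := boolP (x \in U); last first.
  rewrite big1 // => S SU; rewrite ifN ?mul0r //.
  by apply: contra xU; exact: (subsetP SU).
rewrite gE ?setSD // mulr_sumr [RHS](bigID (fun S : {set V} => x \in S)) /=.
rewrite [X in _ = _ + X]big1 ?addr0 => [|S /andP[_ /negPf ->]]; last by rewrite mul0r.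
rewrite [RHS](reindex_onto (fun S => x |: S) (fun S => S :\ x)) /=; last first.
  by move=> S /andP[_ xS]; rewrite setD1K.
apply: eq_big => [S|S SUx].
  rewrite setU11 andbT subUset sub1set xU /= subsetD1 eq_sym.
  case: (boolP (x \in S)) => xS; last by rewrite setU1K ?eqxx // andbT.
  rewrite andbF; apply/esym/negbTE; rewrite negb_and; apply/orP; right.
  by apply: contraTneq xS => ->; rewrite !inE eqxx.
have xS : x \notin S by move: SUx; rewrite subsetD1 => /andP[].
rewrite setU11 setU1K // mulrCA; congr (_ * _).
rewrite /weight -expRD -mulrDr setDDl; congr (expR (_ * _)).
by rewrite addrA subrK.
Qed.

End Cone.

(** * Products of Green's functions lie in the cone *)

Section Generated.
Context (R : realType) (V : finType) (Q : V -> V -> R).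
Implicit Types (S U W : {set V}) (g h : {set V} -> R).

(** The constructors are operations under which [in_cone] is stable. It is not
    obviously stable under products, so monomials are taken as generators, and the
    stability of [green_generated] under products is a double induction. *)
Inductive green_generated W : ({set V} -> R) -> Prop :=
| gen_monomial c (l : seq (V * V)) : 0 <= c ->
    green_generated W (fun U => c * \prod_(e <- l) green Q U e.1 e.2)
| gen_add g h : green_generated W g -> green_generated W h ->
    green_generated W (fun U => g U + h U)
| gen_lim (u : nat -> {set V} -> R) g :
    (forall n, green_generated W (u n)) ->
    (forall U, U \subset W -> u ^~ U @ \oo --> g U) -> green_generated W g.

Lemma gen_eq W g h :
  (forall U, U \subset W -> g U = h U) -> green_generated W g -> green_generated W h.
Proof.
move=> gh gW; apply: (@gen_lim W (fun=> g)) => // U UW.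
by rewrite gh //; exact: cvg_cst.
Qed.

Lemma gen_cst W c : 0 <= c -> green_generated W (fun=> c).
Proof.
move=> c0; apply: gen_eq (gen_monomial W [::] c0) => U _.
by rewrite big_nil mulr1.
Qed.

Lemma gen_green W x y : green_generated W (fun U => green Q U x y).
Proof.
apply: gen_eq (gen_monomial W [:: (x, y)] ler01) => U _.
by rewrite big_seq1 mul1r.
Qed.

Lemma gen_mul W g h :
  green_generated W g -> green_generated W h -> green_generated W (fun U => g U * h U).
Proof.
move=> + hW; elim=> {g} [c l c0|g1 g2 _ IH1 _ IH2|u g _ IH ug].
- elim: hW => {h} [d k d0|h1 h2 _ IH1 _ IH2|u h _ IH uh].
  + apply: gen_eq (gen_monomial W (l ++ k) (mulr_ge0 c0 d0)) => U _.
    by rewrite big_cat /= mulrACA.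
  + by apply: gen_eq (gen_add IH1 IH2) => U _; rewrite mulrDr.
  + by apply: (gen_lim IH) => U UW; apply: cvgMr; exact: uh.
- by apply: gen_eq (gen_add IH1 IH2) => U _; rewrite mulrDl.
- by apply: (gen_lim IH) => U UW; apply: cvgMl; exact: ug.
Qed.

Lemma gen_sum W (I : Type) (r : seq I) (P : pred I) (g : I -> {set V} -> R) :
  (forall i, P i -> green_generated W (g i)) ->
  green_generated W (fun U => \sum_(i <- r | P i) g i U).
Proof.
move=> gW; elim: r => [|i r IH].
  by under eq_fun do rewrite big_nil; exact: gen_cst.
under eq_fun do rewrite big_cons.
by case: (boolP (P i)) => //= Pi; apply: gen_add => //; exact: gW.
Qed.

Lemma gen_prod W (I : Type) (r : seq I) (g : I -> {set V} -> R) :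
  (forall i, green_generated W (g i)) ->
  green_generated W (fun U => \prod_(i <- r) g i U).
Proof.
move=> gW; elim: r => [|i r IH].
  by under eq_fun do rewrite big_nil; exact: gen_cst.
by under eq_fun do rewrite big_cons; exact: gen_mul.
Qed.

Lemma gen_exp W g n : green_generated W g -> green_generated W (fun U => g U ^+ n).
Proof.
move=> gW; elim: n => [|n IH].
  by under eq_fun do rewrite expr0; exact: gen_cst.
by under eq_fun do rewrite exprS; exact: gen_mul.
Qed.

(** The exponential series has nonnegative coefficients. *)
Lemma gen_expR W g : green_generated W g -> green_generated W (fun U => expR (g U)).
Proof.
move=> gW.
apply: (@gen_lim W (fun n U => series (exp_coeff (g U)) n)) => [n|U UW].
  apply: gen_sum => k _; rewrite /exp_coeff /=.
  by apply: gen_mul; [exact: gen_exp|apply: gen_cst; rewrite invr_ge0].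
exact: is_cvg_series_exp_coeff.
Qed.

(** The series of - ln (1 - t) has nonnegative coefficients. *)
Lemma gen_ln_one_sub W g :
  green_generated W g -> (forall U, U \subset W -> 0 <= g U < 1) ->
  green_generated W (fun U => - ln (1 - g U)).
Proof.
move=> gW g01.
apply: (@gen_lim W (fun n U => \sum_(1 <= k < n) k%:R^-1 * g U ^+ k)) => [n|U UW].
  apply: gen_sum => k _; apply: gen_mul; last exact: gen_exp.
  by apply: gen_cst; rewrite invr_ge0.
exact/ln_one_sub_series/g01.
Qed.

End Generated.

Section Positivity.
Context (R : realType) (V : finType) (Q : V -> V -> R) (lambda : R).
Hypothesis trQ : transient Q.
Hypothesis lambda01 : 0 <= lambda <= 1.
Implicit Types (S U W : {set V}) (g h : {set V} -> R).
Let Q0 : forall x y, 0 <= Q x y := proj1 trQ.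
Let Lcone := in_cone (loop_total Q) lambda.

Lemma gen_in_cone W g :
  (forall l : seq (V * V), Lcone W (fun U => \prod_(e <- l) green Q U e.1 e.2)) ->
  green_generated Q W g -> Lcone W g.
Proof.
move=> monoW; elim=> {g} [c l c0|g h _ IHg _ IHh|u g _ IH ug].
- exact: (in_coneZ c0 (monoW l)).
- exact: in_coneD.
- exact: in_cone_lim ug.
Qed.

Lemma gen_entrance W x y : green_generated Q W (fun U => entrance Q U x y).
Proof.
apply: gen_add; first exact/gen_cst/ler0n.
apply: gen_sum => u _; apply: gen_mul; first exact: gen_green.
exact: gen_cst.
Qed.

Lemma gen_departure W x y : green_generated Q W (fun U => departure Q U x y).
Proof.
apply: gen_add; first exact/gen_cst/ler0n.
apply: gen_sum => u _; apply: gen_mul; last exact: gen_green.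
exact: gen_cst.
Qed.

Lemma gen_return_mass W x : green_generated Q W (fun U => return_mass Q U x).
Proof.
apply: gen_sum => u _; apply: gen_mul; last exact: gen_entrance.
exact: gen_cst.
Qed.

(** Induction on the number of points of W, removing the starting point x of the
    first factor. Products are needed even if only single values matter in the
    end: powers of the return mass and the other factors all involve W \ x. *)
Lemma monomial_in_cone W (l : seq (V * V)) :
  Lcone W (fun U => \prod_(e <- l) green Q U e.1 e.2).
Proof.
have [n] := ubnP #|W|; elim: n W l => // n IH W [|[x z] l] /ltnSE Wn.
  by under eq_fun do rewrite big_nil; exact: in_cone_cst.
have [xW|xW] := boolP (x \in W); last first.
  apply: in_cone_eq (in_cone_cst _ _ W (lexx 0)) => U UW.
  rewrite big_cons green_notinl ?mul0r //=.
  by apply: contra xW; exact: (subsetP UW).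
(* With U standing for W \ x, exp (ell U) is 1 / (1 - f), and q collects all of
   the product but (1 - f)^(- lambda). *)
pose ell U := - ln (1 - return_mass Q U x).
pose q U := departure Q U x z * expR ((1 - lambda) * ell U) *
  \prod_(e <- l) (green Q U e.1 e.2 +
                  entrance Q U x e.1 * departure Q U x e.2 * expR (ell U)).
have ret01 U : U \subset W :\ x -> 0 <= return_mass Q U x < 1.
  move=> UW'; rewrite return_mass_ge0 //=.
  have xU : x \notin U by move: UW'; rewrite subsetD1 => /andP[].
  by rewrite -(setU1K xU) return_mass_lt1 // setU11.
have qW : green_generated Q (W :\ x) q.
  have ellW : green_generated Q (W :\ x) ell.
    by apply: gen_ln_one_sub ret01; exact: gen_return_mass.
  apply: gen_mul; first apply: gen_mul.
  - exact: gen_departure.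
  - apply/gen_expR/gen_mul => //; apply: gen_cst.
    by rewrite subr_ge0; case/andP: lambda01.
  - apply: gen_prod => e; apply: gen_add; first exact: gen_green.
    apply: gen_mul; last exact: gen_expR.
    by apply: gen_mul; [exact: gen_entrance|exact: gen_departure].
have {qW} : Lcone (W :\ x) q.
  apply: gen_in_cone qW => k; apply: IH.
  by apply: leq_trans Wn; rewrite [in leqRHS](cardsD1 x) xW.
move=> /(in_cone_insert xW); apply: in_cone_eq => U UW.
case: ifPn => [xU|xU]; last by rewrite big_cons green_notinl ?mul0r.
have expE : expR (ell (U :\ x)) = (1 - return_mass Q (U :\ x) x)^-1.
  by rewrite expRN lnK // posrE subr_gt0 return_mass_lt1.
rewrite loop_total_removal // -/(ell _) /q mulrA mulrCA -expRD -mulrDl.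
rewrite addrCA subrr addr0 mul1r expE big_cons /= green_departure //.
congr (_ * _); apply: eq_bigr => e _.
by rewrite [RHS](green_removal trQ U x) (green_departure trQ xU) mulrA.
Qed.

Lemma Zpart_in_cone W alpha beta :
  (forall x, 0 <= alpha x) -> (forall x, 0 <= beta x) ->
  Lcone W (Zpart Q alpha beta).
Proof.
move=> a0 b0; apply: gen_in_cone (@monomial_in_cone W) _.
have -> : Zpart Q alpha beta =
    (fun U => \sum_x \sum_y alpha x * green Q U x y * beta y).
  by apply/funext => U; exact: Zpart_green.
apply: gen_sum => x _; apply: gen_sum => y _; apply: gen_mul; last exact: gen_cst.
by apply: gen_mul; [exact: gen_cst|exact: gen_green].
Qed.

End Positivity.

(** * Spectral radius and transience *)

Section SpectralRadius.
Context (R : realType).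

Local Notation normc := ComplexField.Normc.normc.

Lemma normc_real (a : R) : 0 <= a -> normc (real_complex R a) = a.
Proof. by move=> a0; rewrite /normc /= expr0n /= addr0 sqrtr_sqr ger0_norm. Qed.

Lemma normc_ge0 (z : R[i]) : 0 <= normc z.
Proof. by case: z => a b; rewrite /normc /= sqrtr_ge0. Qed.

Lemma normc_sum (I : Type) (r : seq I) (F : I -> R[i]) :
  normc (\sum_(i <- r) F i) <= \sum_(i <- r) normc (F i).
Proof.
elim: r => [|i r IH]; first by rewrite !big_nil ComplexField.Normc.normc0.
rewrite !big_cons; apply: (@le_trans _ _ (normc (F i) + normc (\sum_(j <- r) F j))).
  by rewrite -lecR rmorphD /=; exact: (@ler_normD _ R[i]).
exact: lerD.
Qed.

Section Matrix.
Context (n : nat) (A : 'M[R]_n) (c : R).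
Hypothesis A0 : forall i j, 0 <= A i j.
Hypothesis rowA : forall i, \sum_j A i j <= c.

(** For a left eigenvector v, sum the moduli of the entries of v A = z v. *)
Lemma eigenvalue_normc_le (z : R[i]) :
  eigenvalue (map_mx (real_complex R) A) z -> normc z <= c.
Proof.
move=> /eigenvalueP[v vA v0].
pose s := \sum_j normc (v 0 j).
have s0 : 0 < s.
  rewrite lt_neqAle sumr_ge0 ?andbT => [|j _]; last exact: normc_ge0.
  apply: contra v0 => /eqP/esym/psumr_eq0P v0; apply/eqP/rowP => j.
  rewrite mxE; apply: ComplexField.Normc.eq0_normc; apply: v0 => //= k _.
  exact: normc_ge0.
rewrite -(ler_pM2r s0) mulr_sumr.
apply: (@le_trans _ _ (\sum_j \sum_i normc (v 0 i) * A i j)).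
  apply: ler_sum => j _; rewrite -ComplexField.Normc.normcM.
  have -> : z * v 0 j = \sum_i v 0 i * real_complex R (A i j).
    move/matrixP/(_ 0 j): vA; rewrite !mxE => <-.
    by apply: eq_bigr => i _; rewrite mxE.
  apply: le_trans (normc_sum _ _) _; apply: ler_sum => i _.
  by rewrite ComplexField.Normc.normcM normc_real.
rewrite exchange_big mulr_sumr; apply: ler_sum => i _.
by rewrite -mulr_sumr mulrC ler_wpM2r // normc_ge0.
Qed.

Lemma spectral_radius_le : 0 <= c -> spectral_radius A <= c.
Proof.
move=> c0; rewrite /spectral_radius; set E := (X in sup X).
(* Without eigenvalues (n = 0) the supremum of the empty set is 0. *)
have [E0|E0] := eqVneq E classical_sets.set0; first by rewrite E0 sup0.
apply: ge_sup; first exact/set0P.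
by move=> _ [z zA ->]; exact: eigenvalue_normc_le.
Qed.

Lemma eigenvalue1_spectral_radius :
  1%:M - A \notin unitmx -> 1 <= spectral_radius A.
Proof.
move=> A1; apply: ub_le_sup.
  by exists c => _ [z zA ->]; exact: eigenvalue_normc_le.
exists 1; last by rewrite ComplexField.Normc.normc1.
rewrite /eigenvalue /eigenspace kermx_eq0 row_free_unit.
have -> : map_mx (real_complex R) A - 1%:M = map_mx (real_complex R) (A - 1%:M).
  by rewrite map_mxB map_mx1.
by rewrite map_unitmx -opprB -scaleN1r unitmxZ // unitrN1.
Qed.

End Matrix.

(** For a substochastic kernel, the mass u n x of the walks of length n from x
    decreases in n, to a limit l with Q l = l. If l is not 0 then 1 is an
    eigenvalue and the spectral radius is at least 1; so l = 0. *)
Lemma transient_spectral_radius (V : finType) (Q : V -> V -> R) :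
  (forall x y, 0 <= Q x y) -> (forall x, \sum_y Q x y <= 1) ->
  spectral_radius (sub_mx Q [set: V]) < 1 -> transient Q.
Proof.
move=> Q0 Q1 sr; split=> // x y.
pose u n x := \sum_y walk Q [set: V] n x y.
have w0 n a b : 0 <= walk Q [set: V] n a b by exact: walk_ge0.
have u0 n a : 0 <= u n a by rewrite sumr_ge0.
have uS n a : u n.+1 a <= u n a.
  rewrite /u; under eq_bigr do rewrite walkSr inE mul1r.
  rewrite exchange_big /=; apply: ler_sum => z _.
  by rewrite -mulr_sumr ler_piMr.
have u_cvg a : u ^~ a @ \oo --> limn (u ^~ a).
  apply: nonincreasing_is_cvgn; first by apply/nonincreasing_seqP => n; exact: uS.
  by exists 0 => _ [n _ <-].
pose l a := limn (u ^~ a).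
have l_fix a : l a = \sum_z Q a z * l z.
  apply: (cvgn_unique (cvgn_shiftS (u_cvg a))).
  have -> : (fun n => u n.+1 a) = (fun n => \sum_z Q a z * u n z).
    apply/funext => n; rewrite /u /=.
    under eq_bigr do rewrite inE mul1r.
    by rewrite exchange_big; apply: eq_bigr => z _; rewrite mulr_sumr.
  apply: (@cvg_bigsum _ _ _ _ (fun n z => Q a z * u n z) (fun z => Q a z * l z)).
  by move=> z _; apply: cvgMr; exact: u_cvg.
have l0 a : l a = 0.
  (* The limit l is killed by 1 - Q, which is invertible when 1 is not an eigenvalue. *)
  have unitA : 1%:M - sub_mx Q [set: V] \in unitmx.
    apply: contraLR sr => /(@eigenvalue1_spectral_radius _ _ 1).
    rewrite -leNgt; apply=> [i j|i]; first by rewrite mxE.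
    under eq_bigr do rewrite mxE.
    rewrite -(@sum_set_enum _ _ _ (Q (enum_val i))) // => z.
    by rewrite inE.
  have /(congr1 (mulmx (invmx (1%:M - sub_mx Q [set: V])))) :
    (1%:M - sub_mx Q [set: V]) *m sub_cV l [set: V] = 0.
    apply/colP => i; rewrite mulmxBl mul1mx !mxE l_fix.
    rewrite (@sum_set_enum _ _ [set: V]) => [|z]; last by rewrite inE.
    apply/eqP; rewrite subr_eq0; apply/eqP; apply: eq_bigr => j _.
    by rewrite !mxE.
  rewrite mulKmx // mulmx0 => /colP/(_ (enum_rank_in (in_setT a) a)).
  by rewrite !mxE enum_rankK_in.
have u_cvg0 : u ^~ x @ \oo --> (0 : R) by rewrite -(l0 x); exact: u_cvg.
apply: (squeeze_cvgr _ (cvg_cst 0) u_cvg0).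
near=> n; rewrite w0 /= /u (bigD1 y) //= lerDl sumr_ge0.
Unshelve. all: by end_near. Qed.

End SpectralRadius.

(** * Loop mass by inclusion-exclusion *)

Section LoopMass.
Context (R : realType) (V : finType).
Implicit Types (Q : V -> V -> R) (S U W : {set V}).

Definition path_weight Q n (x : {ffun 'I_n.+1 -> V}) : R :=
  \prod_(i < n) Q (x (inord i)) (x (inord i.+1)).

Definition ffun_cons n (a : V) (y : {ffun 'I_n -> V}) : {ffun 'I_n.+1 -> V} :=
  [ffun i => if unlift ord0 i is Some j then y j else a].

Lemma ffun_cons0 n a (y : {ffun 'I_n -> V}) : ffun_cons a y ord0 = a.
Proof. by rewrite ffunE unlift_none. Qed.

Lemma ffun_consS n a (y : {ffun 'I_n -> V}) j : ffun_cons a y (lift ord0 j) = y j.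
Proof. by rewrite ffunE liftK. Qed.

Lemma ffun_cons_bij n :
  bijective (fun p : V * {ffun 'I_n -> V} => ffun_cons p.1 p.2).
Proof.
exists (fun x : {ffun 'I_n.+1 -> V} => (x ord0, [ffun j => x (lift ord0 j)])).
  move=> [a y] /=; rewrite ffun_cons0; congr (_, _).
  by apply/ffunP => j; rewrite ffunE ffun_consS.
move=> x; apply/ffunP => i /=.
by case: (unliftP ord0 i) => [j|] ->; rewrite ?ffun_consS ?ffun_cons0 ?ffunE.
Qed.

Lemma path_weight_cons Q n a (y : {ffun 'I_n.+1 -> V}) :
  path_weight Q (ffun_cons a y) = Q a (y ord0) * path_weight Q y.
Proof.
have inordS k : (k <= n)%N -> inord k.+1 = lift ord0 (inord k : 'I_n.+1).
  by move=> kn; apply: val_inj; rewrite /= !inordK.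
have x0 : ffun_cons a y (inord 0) = a.
  by rewrite (_ : inord 0 = ord0) ?ffun_cons0 //; apply: val_inj; rewrite /= inordK.
have xS k : (k <= n)%N -> ffun_cons a y (inord k.+1) = y (inord k).
  by move=> kn; rewrite inordS // ffun_consS.
rewrite /path_weight big_ord_recl /= x0 xS //; congr (Q _ (y _) * _).
  by apply: val_inj; rewrite /= inordK.
by apply: eq_bigr => i _; rewrite !xS //; exact: ltnW.
Qed.

Lemma sum_paths_walk Q W n a b :
  \sum_(x : {ffun 'I_n.+1 -> V} |
      [&& x ord0 == a, x ord_max == b & [forall i, x i \in W]]) path_weight Q x
  = walk Q W n a b.
Proof.
elim: n a => [|n IH] a.
  rewrite [walk _ _ _ _ _]/=.
  have [/andP[/eqP <- aW]|ab] := boolP ((a == b) && (b \in W)).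
    rewrite (big_pred1 [ffun=> a]) => [|x]; first by rewrite /path_weight big_ord0.
    have e0 : ord_max = ord0 :> 'I_1 by apply: val_inj.
    rewrite e0 andbA andbb; apply/andP/eqP => [[/eqP xa _]|->].
      by apply/ffunP => i; rewrite ffunE (ord1 i).
    rewrite ffunE; split=> //; apply/forallP => i; by rewrite ffunE.
  rewrite big_pred0 // => x; apply: contraNF ab => /= /and3P[/eqP <- /eqP <- /forallP xW].
  rewrite xW andbT; apply/eqP; congr (x _); exact: val_inj.
rewrite (reindex _ (onW_bij _ (ffun_cons_bij n.+1))) /=.
pose C (y : {ffun 'I_n.+1 -> V}) := (y ord_max == b) && [forall i, y i \in W].
(* Split off the starting point of the path. *)
have condE (p : V * {ffun 'I_n.+1 -> V}) :
    [&& ffun_cons p.1 p.2 ord0 == a, ffun_cons p.1 p.2 ord_max == b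
      & [forall i, ffun_cons p.1 p.2 i \in W]] =
    (p.1 == a) && ((a \in W) && C p.2).
  rewrite ffun_cons0; case: eqP => //= ->.
  have -> : ord_max = lift ord0 ord_max :> 'I_n.+2 by apply: val_inj.
  rewrite ffun_consS andbCA; congr (_ && _).
  apply/forallP/andP => [xW|[aW /forallP yW] i].
    split; first by rewrite -[a](ffun_cons0 a p.2).
    by apply/forallP => j; rewrite -(ffun_consS a).
  by case: (unliftP ord0 i) => [j|] ->; rewrite ?ffun_consS ?ffun_cons0.
under eq_bigl do rewrite condE.
under eq_bigr do rewrite path_weight_cons.
have [aW|aW] /= := boolP (a \in W); last first.
  by rewrite mul0r big_pred0 // => p; rewrite andbF.
rewrite -(pair_big (pred1 a) C (fun u y => Q u (y ord0) * path_weight Q y)) /=.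
rewrite big_pred1_eq mul1r (partition_big (fun y : {ffun 'I_n.+1 -> V} => y ord0) predT) //=.
apply: eq_bigr => z _; rewrite -IH mulr_sumr.
apply: eq_big => [y|y /andP[_ /eqP ->]] //.
by rewrite /C andbC.
Qed.

Lemma sum_closed_paths Q W n :
  \sum_(x : {ffun 'I_n.+1 -> V} | (x ord_max == x ord0) && [forall i, x i \in W])
    path_weight Q x = closed_walks Q W n.
Proof.
rewrite (partition_big (fun x : {ffun 'I_n.+1 -> V} => x ord0) predT) //=.
apply: eq_bigr => a _; rewrite -sum_paths_walk; apply: eq_bigl => x.
by case: (x ord0 =P a) => [->|]; rewrite ?andbF ?andbT.
Qed.

(** Inclusion-exclusion, closed path by closed path: a path misses S when it stays
    in the complement of S, and misses the complement of W when it stays in W. *)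
Lemma loop_sum_closed_walks Q S W n : loop_sum Q S (~: W) n = n%:R^-1 *
  (closed_walks Q [set: V] n - closed_walks Q (~: S) n
   - closed_walks Q W n + closed_walks Q (W :\: S) n).
Proof.
rewrite /loop_sum -mulr_sumr; congr (_ * _).
rewrite -!sum_closed_paths !big_mkcondr -!sumrB -big_split /=.
apply: eq_bigr => x _; rewrite -/(path_weight Q x).
have -> : [forall i, x i \in [set: V]%SET] by apply/forallP => i; rewrite inE.
have -> : hits x S = ~~ [forall i, x i \in ~: S].
  by rewrite negb_forall; apply: eq_existsb => i; rewrite inE negbK.
have -> : hits x (~: W) = ~~ [forall i, x i \in W].
  by rewrite negb_forall; apply: eq_existsb => i; rewrite inE.
have -> : [forall i, x i \in W :\: S] =
    [forall i, x i \in ~: S] && [forall i, x i \in W].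
  apply/forallP/andP => [xWS|[/forallP xS /forallP xW] i].
    by split; apply/forallP => i; have := xWS i; rewrite !inE => /andP[].
  by have := xS i; rewrite !inE xW andbT.
by case: [forall i, x i \in ~: S]; case: [forall i, x i \in W] => /=; ring.
Qed.

Lemma loop_massE Q S W : transient Q -> loop_mass Q S (~: W) =
  loop_total Q [set: V] - loop_total Q (~: S)
  - loop_total Q W + loop_total Q (W :\: S).
Proof.
move=> trQ; apply: (@cvg_lim _ _ _ _ _ _ _ _) => //.
have -> : (fun N => \sum_(1 <= n < N) loop_sum Q S (~: W) n) = (fun N =>
    loop_partial Q [set: V] N - loop_partial Q (~: S) N
    - loop_partial Q W N + loop_partial Q (W :\: S) N).
  apply/funext => N; rewrite -!sumrB -big_split; apply: eq_bigr => n _.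
  by rewrite loop_sum_closed_walks !mulrDr !mulrN.
apply: cvgD; last exact: loop_partial_cvg.
by apply: cvgB; [apply: cvgB|]; exact: loop_partial_cvg.
Qed.

Lemma loop_mass_setT Q S : transient Q -> loop_mass Q S (~: [set: V]) = 0.
Proof. by move=> trQ; rewrite loop_massE // setTD; ring. Qed.

(** The factor depending on S alone can be absorbed in the unknown p S. *)
Lemma expR_loop_mass Q lambda S W : transient Q -> S \subset W ->
  expR (- (lambda * loop_mass Q S (~: W))) =
  weight (loop_total Q) lambda S W / weight (loop_total Q) lambda S [set: V].
Proof.
move=> trQ SW; rewrite loop_massE // -expRB -setTD; congr expR; ring.
Qed.

End LoopMass.

Section System.
Context (R : realType) (V : finType).

Lemma triangular_unique (c : {set V} -> {set V} -> R) (p q : {ffun {set V} -> R}) :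
  (forall S, c S S != 0) ->
  (forall W : {set V}, \sum_(S : {set V}) p S * (S \subset W)%:R * c S W =
             \sum_(S : {set V}) q S * (S \subset W)%:R * c S W) -> p = q.
Proof.
move=> c0 pq; apply/ffunP => W; have [n] := ubnP #|W|.
elim: n W => // n IH W /ltnSE Wn.
have := pq W; rewrite (bigD1 W) //= [RHS](bigD1 W) //= subxx !mulr1.
have -> : \sum_(S : {set V} | S != W) p S * (S \subset W)%:R * c S W =
          \sum_(S : {set V} | S != W) q S * (S \subset W)%:R * c S W.
  apply: eq_bigr => S SW; have [sSW|] := boolP (S \subset W); last by rewrite !mulr0 !mul0r.
  rewrite IH //; apply: leq_trans (proper_card _) Wn.
  by rewrite properEneq SW.
by move/addIr/(mulIf (c0 W)).
Qed.

Lemma solves_system_unique (Q : V -> V -> R) alpha beta lambda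
    (p : {ffun {set V} -> R}) :
  solves_system Q alpha beta lambda p ->
  unique (solves_system Q alpha beta lambda) p.
Proof.
move=> ps; split=> // q qs.
apply: (triangular_unique (c := fun S W => expR (- (lambda * loop_mass Q S (~: W))))).
  by move=> S; rewrite gt_eqF // expR_gt0.
by move=> W; rewrite ps qs.
Qed.

End System.

(** * The two halves of the theorem *)

Local Close Scope classical_set_scope.

Lemma transient_datum (R : realType) (V : finType) (Q : V -> V -> R) alpha beta :
  finite_datum Q alpha beta -> transient Q.
Proof. by case=> Q0 Q1 sr _ _ _; exact: transient_spectral_radius. Qed.

(** The coefficients p0 of Z in the cone are rescaled to cancel the factors of the
    system that depend on S alone; the total mass is the equation of the full
    set, for which all loop masses vanish. *)
Lemma solution_is_probability (R : realType) (V : finType) (Q : V -> V -> R)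
    (alpha beta : V -> R) (lambda : R) :
  finite_datum Q alpha beta -> 0 <= lambda <= 1 ->
  exists p : {ffun {set V} -> R},
    unique (solves_system Q alpha beta lambda) p /\ is_probability p.
Proof.
move=> datum lambda01; have trQ := transient_datum datum.
have [_ _ _ alpha0 beta0 Z0] := datum.
have [p0 p0_ge0 p0E] := Zpart_in_cone trQ lambda01 [set: V] alpha0 beta0.
pose wV S := weight (loop_total Q) lambda S [set: V].
have wV0 S : 0 < wV S by exact: expR_gt0.
pose p := [ffun S => p0 S * wV S / Zpart Q alpha beta [set: V]].
have p_ge0 S : 0 <= p S.
  by rewrite ffunE divr_ge0 ?mulr_ge0 // ltW.
have psys : solves_system Q alpha beta lambda p.
  move=> W; rewrite /hfun p0E ?subsetT // mulr_suml [RHS]big_mkcond /=.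
  apply: eq_bigr => S _; case: ifP => [SW|_]; last by rewrite mulr0 mul0r.
  rewrite ffunE mulr1 expR_loop_mass // -/(wV S).
  by field; rewrite !gt_eqF.
exists p; split; first exact: solves_system_unique.
split=> //; have := psys [set: V].
rewrite /hfun divff ?gt_eqF // => <-; apply: eq_bigr => S _.
by rewrite subsetT mulr1 loop_mass_setT // mulr0 oppr0 expR0 mulr1.
Qed.

Section TwoPoints.
Context (R : realType) (lambda : R).
Hypothesis lambda1 : 1 < lambda.

Definition flipQ (u v : bool) : R := if u == v then 0 else 2^-1.
Definition at_true (u : bool) : R := (u == true)%:R.

Let S1 : {set bool} := [set true].

Let flipQ_ge0 u v : 0 <= flipQ u v.
Proof. by rewrite /flipQ; case: ifP => _ //; rewrite invr_ge0. Qed.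

Let flipQ_row u : \sum_v flipQ u v = 2^-1.
Proof. by rewrite big_bool /flipQ; case: u => /=; ring. Qed.

Let flipQ_radius : spectral_radius (sub_mx flipQ [set: bool]) < 1.
Proof.
apply: (@le_lt_trans _ _ (2^-1 : R)); last by lra.
apply: spectral_radius_le => [i j|i|]; [by rewrite mxE| |by rewrite invr_ge0].
under eq_bigr do rewrite mxE.
rewrite -(@sum_set_enum _ _ [set: bool] (flipQ (enum_val i))) ?flipQ_row //.
by move=> z; rewrite inE.
Qed.

Let trQ : transient flipQ.
Proof.
apply: transient_spectral_radius => // u; rewrite flipQ_row; lra.
Qed.

Let return_mass0 u : return_mass flipQ set0 u = 0.
Proof.
rewrite /return_mass big1 // => v _; have [->|vu] := eqVneq v u.
  by rewrite /flipQ eqxx mul0r.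
by rewrite entrance_notin ?inE ?mulr0.
Qed.

Let greenS1 : green flipQ S1 true true = 1.
Proof. by rewrite green_self ?set11 // setDv return_mass0 subr0 invr1. Qed.

Let return_mass_true : return_mass flipQ ([set: bool] :\ true) true = 4^-1.
Proof.
have -> : [set: bool] :\ true = [set false] by apply/setP => -[]; rewrite !inE.
rewrite /return_mass big_bool /= {1}/flipQ /= mul0r add0r /entrance big_bool /=.
have -> : green flipQ [set false] false false = 1.
  by rewrite green_self ?set11 // setDv return_mass0 subr0 invr1.
by rewrite /flipQ /=; field.
Qed.

Let greenT : green flipQ [set: bool] true true = (3 / 4)^-1.
Proof. by rewrite green_self ?inE // return_mass_true; congr (_^-1); field. Qed.

Let loop_massS1 : loop_mass flipQ S1 (~: S1) = - ln (3 / 4).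
Proof.
rewrite loop_massE // setDv -setTD.
have e1 := loop_total_removal trQ (set11 true).
have e2 := loop_total_removal trQ (in_setT true).
rewrite setDv return_mass0 subr0 ln1 oppr0 in e1.
rewrite return_mass_true in e2.
have <- : 1 - 4^-1 = 3 / 4 :> R by field.
by rewrite -e2; move/eqP: e1; rewrite subr_eq0 => /eqP ->; rewrite subrK.
Qed.

Let datum : finite_datum flipQ at_true at_true.
Proof.
split=> //; try by move=> u; exact: ler0n.
  by move=> u; rewrite flipQ_row; lra.
by rewrite -/(green flipQ [set: bool] true true) greenT invr_gt0; lra.
Qed.

Let c := expR ((1 - lambda) * ln (3 / 4)).

Let c_gt1 : 1 < c.
Proof.
rewrite expR_gt1 nmulr_rgt0 ?subr_lt0 //.
by apply: ln_lt0; apply/andP; split; lra.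
Qed.

Let p : {ffun {set bool} -> R} :=
  [ffun S : {set bool} => c * (S == S1)%:R + (1 - c) * (S == [set: bool])%:R].

Let p_solves : solves_system flipQ at_true at_true lambda p.
Proof.
move=> W.
have hE : hfun flipQ at_true at_true W = 3 / 4 * green flipQ W true true.
  rewrite /hfun -/(green flipQ W true true) -/(green flipQ [set: bool] true true).
  by rewrite greenT invrK mulrC.
pose e (S : {set bool}) := (S \subset W)%:R * expR (- (lambda * loop_mass flipQ S (~: W))).
have -> : \sum_(S : {set bool})
    p S * (S \subset W)%:R * expR (- (lambda * loop_mass flipQ S (~: W))) =
    c * e S1 + (1 - c) * e [set: bool].
  have pick S0 (a : R) : a * e S0 = \sum_(S : {set bool}) a * (S == S0)%:R * e S.
    rewrite (bigD1 S0) //= eqxx mulr1 big1 ?addr0 // => S /negPf ->.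
    by rewrite mulr0 mul0r.
  rewrite !pick -big_split; apply: eq_bigr => S _ /=.
  by rewrite ffunE /e; ring.
have eT (S : {set bool}) : W = [set: bool] -> e S = 1.
  by move=> WT; rewrite /e WT subsetT loop_mass_setT // mulr0 oppr0 expR0 mulr1.
rewrite hE; have [tW|tW] := boolP (true \in W); last first.
  have WS : S1 \subset W = false by rewrite sub1set (negPf tW).
  have WT : [set: bool] \subset W = false.
    by apply: contraNF tW => /subsetP; apply; rewrite inE.
  by rewrite green_notinl // /e WS WT !mul0r !mulr0 addr0.
have [fW|fW] := boolP (false \in W).
  have WT : W = [set: bool] by apply/setP => -[]; rewrite inE ?tW ?fW.
  by rewrite !eT // WT greenT; field.
have WS : W = S1 by apply/setP => -[]; rewrite inE ?tW ?(negPf fW).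
have WT : [set: bool] \subset W = false.
  by apply: contraNF fW => /subsetP; apply; rewrite inE.
rewrite {2}/e WT mul0r mulr0 addr0 /e WS subxx mul1r loop_massS1 greenS1 mulr1.
rewrite /c -expRD.
have -> : (1 - lambda) * ln (3 / 4) - lambda * - ln (3 / 4) = ln (3 / 4 : R) by ring.
by rewrite lnK // posrE; lra.
Qed.

(** Only loops using both points exist, so the loop mass between the two points is
    - ln (1 - 1/4), while Z at the first point is 1 and Z at both is 4/3. Hence
    the coordinate c of the first point is (3/4) exp (- lambda ln (3/4)) > 1, and
    the full set gets 1 - c. *)
Lemma two_point_counterexample :
  finite_datum flipQ at_true at_true /\
  exists p : {ffun {set bool} -> R},
    unique (solves_system flipQ at_true at_true lambda) p /\
    exists S : {set bool}, p S < 0.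
Proof.
split=> //; exists p; split; first exact: solves_system_unique.
exists [set: bool]; rewrite ffunE eqxx.
have -> : ([set: bool] == S1) = false.
  by apply/negbTE/eqP => /setP/(_ false); rewrite !inE.
by rewrite mulr0 add0r mulr1 subr_lt0.
Qed.

End TwoPoints.

Theorem theorem1p3 (R : realType) :
  (forall (V : finType) (Q : V -> V -> R) (alpha beta : V -> R) (lambda : R),
     finite_datum Q alpha beta -> 0 <= lambda <= 1 ->
     exists p : {ffun {set V} -> R},
       unique (solves_system Q alpha beta lambda) p /\ is_probability p) /\
  (forall lambda : R, 1 < lambda ->
     exists (V : finType) (Q : V -> V -> R) (alpha beta : V -> R),
       finite_datum Q alpha beta /\
       exists p : {ffun {set V} -> R},
         unique (solves_system Q alpha beta lambda) p /\
         exists S : {set V}, p S < 0).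
Proof.
split; first by move=> *; exact: solution_is_probability.
move=> lambda lambda1; exists bool, (@flipQ R), (@at_true R), (@at_true R).
exact: two_point_counterexample.
Qed.
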